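(* Let $f=(f_n)$ be a function on the vertex set of the weighted network $G(B)$ associated to a generalized Bratteli diagram $B$, where $f_n$ is a function on $V_n$. Then $f$ is harmonic if and only if $$2f_n(v)=\sum_{u\in V_{n+1}}\widehat p_n(v,u)f_{n+1}(u)+\sum_{w\in V_{n-1}}\widehat q_{n-1}(v,w)f_{n-1}(w),\qquad \forall n\in\mathbb N,$$ or, equivalently, $2f_n=\widehat P_nf_{n+1}+\widehat Q_{n-1}f_{n-1}$. Similarly, $f$ is harmonic if and only if $D_nf_n=\widehat P_nf_{n+1}+\widehat Q_{n-1}f_{n-1}$, where $D_n$ is the diagonal matrix with entries $2q^{(n)}_v$, $v\in V_n$, on the main diagonal, $n\ge 1$. In particular, $$q^{(n)}M=\tfrac12\big(q^{(n+1)}+q^{(n-1)}\big),\qquad n\in\mathbb N.$$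
   Context: A generalized Bratteli diagram $B=(V,E)$ is a graded graph with $V=\bigsqcup_{n\ge0}V_n$, each $V_n$ being a copy of a fixed countably infinite set $V_0$, and $E=\bigsqcup_{n\ge 0}E_n$, where $E_n$ is the set of edges between $V_n$ and $V_{n+1}$. Each $e\in E_n$ has a source $s(e)\in V_n$ and a range $r(e)\in V_{n+1}$. For $w\in V_n$, $v\in V_{n+1}$ the set $E(w,v)$ of edges with source $w$ and range $v$ is finite (possibly empty). The incidence matrix $F_n=(|E(w,v)|: v\in V_{n+1}, w\in V_n)$ has only finitely many non-zero entries in each row and has no zero row and no zero column. Let $P_n=(p^{(n)}_{v,e}: v\in V_n, e\in E_n)$, $n\ge0$, be Markov matrices: $p^{(n)}_{v,e}\ge 0$, $p^{(n)}_{v,e}>0\iff s(e)=v$, $\sum_{e:\,s(e)=v}p^{(n)}_{v,e}=1$. Let $q^{(0)}$ be a positive vector on $V_0$. For $v\in V_n$, $u\in V_{n+1}$ put $\widehat p_n(v,u)=\sum_{e\in E(v,u)}p^{(n)}_{v,e}$, $q^{(n+1)}_u=\sum_{v\in V_n}q^{(n)}_v\widehat p_n(v,u)$, $\widehat q_n(u,v)=\frac{q^{(n)}_v}{q^{(n+1)}_u}\widehat p_n(v,u)$, and $\widehat P_n=(\widehat p_n(v,u))$, $\widehat Q_n=(\widehat q_n(u,v))$. These matrices are row stochastic, and $q^{(n)}\widehat P_n=q^{(n+1)}$, $q^{(n+1)}\widehat Q_n=q^{(n)}$ for the row vectors $q^{(n)}$. The weighted network $G(B)$ has vertex set $V$;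 $v\in V_n$ and $u\in V_{n+1}$ are joined by a single edge, with conductance $\frac12q^{(n)}_v\widehat p_n(v,u)$, if and only if $E(v,u)\ne\emptyset$; write $u\sim v$ for adjacency. The Markov kernel is $M=\{m(v,u): v,u\in V\}$ with $m(v,u)=\frac12\widehat p_n(v,u)$ if $v\in V_n$, $u\in V_{n+1}$, and $m(v,u)=\frac12\widehat q_{n-1}(v,u)$ if $v\in V_n$, $u\in V_{n-1}$. The Markov operator is $(Mf)(v)=\sum_{u\sim v}m(v,u)f(u)$, $v\in V$. A function $f$ is harmonic if $Mf=f$. In $q^{(n)}M$, the vector $q^{(n)}$ is a row vector indexed by $V_n$ multiplied by the matrix $M$.
   Formalization: The D_n claim is false as written (rescaling q^(0) changes D_n but not harmonicity); it is proved with both matrices on its right side multiplied by the diagonal matrix of q^(n), and its equations are required also at n = 0, where the term with index n-1 is zero. *)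

(* Defs.v *)
From HB Require Import structures.
From mathcomp Require Import all_boot all_order all_algebra finmap.
From mathcomp Require Import boolp classical_sets functions cardinality fsbigop.
From mathcomp Require Import constructive_ereal reals ereal numfun esum.

Set Implicit Arguments.
Unset Strict Implicit.
Unset Printing Implicit Defensive.

Import Order.TTheory GRing.Theory Num.Theory.
Local Open Scope classical_set_scope.
Local Open Scope ring_scope.

Definition edge_set (E V : Type) (s r : E -> V) (w v : V) : set E :=
  [set e | s e = w /\ r e = v].

(* The set of edges is finite in every use; fset_set of an infinite set is
   empty, hence the separate finiteness axiom below. *)
Definition incidence (E : choiceType) (V : Type) (s r : E -> V) (v w : V) : nat :=
  #|` fset_set (edge_set s r w v)|.

(* V_n is the copy {n} x V0 of V0; an edge of E_n goes from (n, bd_src e) to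
   (n.+1, bd_rng e). *)
Record gbratteli := GBratteli {
  bd_V0 : countType;
  bd_E : nat -> choiceType;
  bd_src : forall n, bd_E n -> bd_V0;
  bd_rng : forall n, bd_E n -> bd_V0;
  bd_infinite : infinite_set [set: bd_V0];
  bd_finite_edges : forall n w v,
    finite_set (edge_set (@bd_src n) (@bd_rng n) w v);
  bd_finite_row : forall n v,
    finite_set [set w | incidence (@bd_src n) (@bd_rng n) v w != 0%N];
  bd_row_neq0 : forall n v,
    exists w, incidence (@bd_src n) (@bd_rng n) v w != 0%N;
  bd_col_neq0 : forall n w,
    exists v, incidence (@bd_src n) (@bd_rng n) v w != 0%N
}.

Definition edges (B : gbratteli) (n : nat) (w v : bd_V0 B) : set (bd_E B n) :=
  edge_set (@bd_src B n) (@bd_rng B n) w v.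

Arguments edges {B} n w v.

Definition vertex (B : gbratteli) : countType := (nat * bd_V0 B)%type.

Definition adjacent (B : gbratteli) (x y : vertex B) : Prop :=
  (y.1 = x.1.+1 /\ edges x.1 x.2 y.2 !=set0) \/
  (x.1 = y.1.+1 /\ edges y.1 y.2 x.2 !=set0).

(* The unordered sum of a real family. Since +oo - +oo = -oo in \bar R, it is a
   real number exactly when the family is absolutely summable. *)
Definition usum (R : realType) (T : choiceType) (A : set T) (a : T -> R) :
    \bar R :=
  (\esum_(i in A) (EFin \o a)^\+ i - \esum_(i in A) (EFin \o a)^\- i)%E.

Definition matvec (R : realType) (S : Type) (T : choiceType)
    (A : S -> T -> R) (g : T -> R) : S -> \bar R :=
  fun s => usum [set: T] (fun t => A s t * g t).

Definition vecmat (R : realType) (S : choiceType) (T : Type)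
    (g : S -> R) (A : S -> T -> R) : T -> \bar R :=
  fun t => usum [set: S] (fun s => g s * A s t).

Definition diag_matrix (R : realType) (T : eqType) (d : T -> R) : T -> T -> R :=
  fun s t => if s == t then d s else 0.

Section Network.
Variables (R : realType) (B : gbratteli).
Local Notation V0 := (bd_V0 B).

Definition markov_matrices (p : forall n, V0 -> bd_E B n -> R) : Prop :=
  forall n v,
    [/\ forall e, 0 <= p n v e,
        forall e, 0 < p n v e <-> bd_src e = v &
        \esum_(e in [set e | bd_src e = v]) (p n v e)%:E = 1%:E].

Variables (p : forall n, V0 -> bd_E B n -> R) (q0 : V0 -> R).

Definition phat (n : nat) (v u : V0) : R := \sum_(e \in edges n v u) p v e.

(* Rows of F_n being finite, the sum over v has finite support. *)
Fixpoint qvec (n : nat) : V0 -> R :=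
  if n is k.+1 then
    fun u => \sum_(v \in [set: V0]) (qvec k v * phat k v u)
  else q0.

Definition qhat (n : nat) (u v : V0) : R :=
  qvec n v / qvec n.+1 u * phat n v u.

Definition markov_kernel (x y : vertex B) : R :=
  if y.1 == x.1.+1 then 2^-1 * phat x.1 x.2 y.2
  else if x.1 == y.1.+1 then 2^-1 * qhat y.1 x.2 y.2
  else 0.

Definition markov_op (f : vertex B -> R) (x : vertex B) : \bar R :=
  usum [set y | adjacent x y] (fun y => markov_kernel x y * f y).

(* The equality in \bar R makes absolute convergence of (Mf)(x) part of
   harmonicity. *)
Definition is_harmonic (f : vertex B -> R) : Prop :=
  forall x, markov_op f x = (f x)%:E.

Definition level (f : vertex B -> R) (n : nat) : V0 -> R := fun v => f (n, v).

(* Q_{n-1} f_{n-1}, where V_{-1} is empty. *)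
Definition qhat_prev (f : vertex B -> R) (n : nat) : V0 -> \bar R :=
  if n is k.+1 then matvec (qhat k) (level f k) else fun=> 0%E.

(* diag(d) Q_{n-1} f_{n-1}. For d = q^(n), the entries q^(n)_v qhat_{n-1}(v, w)
   = q^(n-1)_w phat_{n-1}(w, v), like the entries q^(n)_v phat_n(v, u), are twice
   the conductances of the network. *)
Definition weighted_qhat_prev (d : V0 -> R) (f : vertex B -> R) (n : nat) :
    V0 -> \bar R :=
  if n is k.+1 then matvec (fun v w => d v * qhat k v w) (level f k)
  else fun=> 0%E.

Definition qvecM (n : nat) : vertex B -> \bar R :=
  vecmat (qvec n) (fun v x => markov_kernel (n, v) x).

(* The vector q^(n) as a row vector indexed by V, supported on V_n; the second
   one is q^(n-1), which is 0 for n = 0. *)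
Definition qvec_ext (n : nat) (x : vertex B) : R :=
  if x.1 == n then qvec n x.2 else 0.

Definition qvec_ext_prev (n : nat) (x : vertex B) : R :=
  if n is k.+1 then qvec_ext k x else 0.

End Network.

(* Main.v *)
(* The neighbours of (n, v) in G(B) lie on the levels n+1 and n-1, so (Mf)(n, v)
   is half of (P_n f_{n+1})(v) + (Q_{n-1} f_{n-1})(v). Summability plays no role:
   in \bar R the junk value +oo - +oo = -oo is absorbing, so unordered sums are
   additive on disjoint sets and commute with positive factors even when they
   diverge. Multiplying row v by q^(n)_v > 0 gives the form with D_n. The level
   n+1 part of q^(n) M is half of the definition of q^(n+1), and the level n-1
   part is q^(n-1) / 2 by reversibility,
   q^(n)_v qhat_{n-1}(v, w) = q^(n-1)_w phat_{n-1}(w, v), and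
   sum_v phat_{n-1}(w, v) = 1. *)

Require Import Defs.
From mathcomp Require Import all_boot all_order all_algebra.
From mathcomp Require Import boolp classical_sets functions cardinality fsbigop.
From mathcomp Require Import constructive_ereal reals ereal numfun esum.

Set Implicit Arguments.
Unset Strict Implicit.
Unset Printing Implicit Defensive.

Import Order.TTheory GRing.Theory Num.Theory.
Local Open Scope classical_set_scope.
Local Open Scope ring_scope.

(* Unlike in [muleDr], [x + y] may be the junk value [+oo - +oo = -oo]. *)
Lemma gt0_muleDr (R : realType) (r : R) (x y : \bar R) : 0 < r ->
  (r%:E * (x + y) = r%:E * x + r%:E * y)%E.
Proof.
move=> r0; case: x y => [x| |] [y| |] //;
  rewrite ?gt0_muley ?gt0_muleNy ?lte_fin//.
by rewrite -EFinD -!EFinM -EFinD mulrDr.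
Qed.

(** * Calculus of unordered real sums in the extended reals *)

Section UnorderedSums.
Variables (R : realType) (T : choiceType).
Implicit Types (A D : set T) (a b : T -> R).

(** The factor comes out of every finite partial sum, and scaling by [r > 0] commutes with
    suprema. *)
Lemma esum_pZl A (r : R) (a : T -> \bar R) : 0 < r -> (forall i, 0 <= a i)%E ->
  (\esum_(i in A) (r%:E * a i) = r%:E * \esum_(i in A) a i)%E.
Proof.
move=> r0 a0; rewrite /esum -ereal_sup_pZl//; congr ereal_sup.
apply/seteqP; split => [_ [F FA <-]|_ [_ [F FA <-] <-]].
  by exists (\sum_(i \in F) a i)%E; [exists F | rewrite ge0_mule_fsumr].
by exists F => //; rewrite ge0_mule_fsumr.
Qed.

Lemma eq_usum A a b : (forall i, A i -> a i = b i) -> usum A a = usum A b.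
Proof.
move=> ab; rewrite /usum; congr (_ - _)%E; apply: eq_esum => i Ai.
  by rewrite !funeposE /= ab.
by rewrite !funenegE /= ab.
Qed.

(** Lets a sum over neighbours be read as a sum over a whole level: positive and negative parts both
    vanish on [D] outside [A]. *)
Lemma usum_widen A D a : A `<=` D -> (forall i, D i -> ~ A i -> a i = 0) ->
  usum D a = usum A a.
Proof.
move=> AD a0; rewrite /usum; congr (_ - _)%E.
  rewrite (esumID A D) ?(setIidr AD); last by move=> i _; exact: funepos_ge0.
  rewrite [X in (_ + X)%E]esum1 ?adde0// => i [Di nAi].
  by rewrite funeposE /= a0// maxxx.
rewrite (esumID A D) ?(setIidr AD); last by move=> i _; exact: funeneg_ge0.
rewrite [X in (_ + X)%E]esum1 ?adde0// => i [Di nAi].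
by rewrite funenegE /= a0// oppr0 maxxx.
Qed.

Lemma usum_pZl A (r : R) a : 0 < r ->
  usum A (fun i => r * a i) = (r%:E * usum A a)%E.
Proof.
move=> r0; rewrite /usum.
rewrite (_ : EFin \o (fun i => r * a i) = (fun i => r%:E * (EFin \o a) i)%E)//.
rewrite ge0_funeposM ?ge0_funenegM ?ltW//.
by rewrite !esum_pZl// gt0_muleDr// muleN.
Qed.

Lemma ge0_usum A a : (forall i, A i -> 0 <= a i) ->
  usum A a = \esum_(i in A) (a i)%:E.
Proof.
move=> a0; rewrite /usum [X in (_ - X)%E]esum1 ?sube0 => [|i Ai].
  by apply: eq_esum => i Ai; rewrite funeposE /= max_l// lee_fin a0.
by rewrite funenegE /= max_r// lee_fin oppr_le0 a0.
Qed.

Lemma fset_usum A a : finite_set A -> usum A a = (\sum_(i \in A) a i)%:E.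
Proof.
move=> fA; rewrite /usum !esum_fset//.
rewrite (eq_fsbigr (fun i => (Num.max (a i) 0)%:E)); last first.
  by move=> i _; rewrite funeposE EFin_max.
rewrite [X in (_ - X)%E](eq_fsbigr (fun i => (Num.max (- a i) 0)%:E));
  last first.
  by move=> i _; rewrite funenegE EFin_max.
(* Both sums are now real, and termwise [max (a i) 0 - max (- a i) 0 = a i]. *)
rewrite !fsumEFin// -EFinB; congr EFin; rewrite !fsbig_finite//= -sumrB.
apply: eq_bigr => i _; case: (leP 0 (a i)) => ai.
  by rewrite max_r ?subr0// oppr_le0.
by rewrite max_l ?sub0r ?opprK// oppr_ge0 ltW.
Qed.

Lemma finite_support_usum D A a : finite_set A -> A `<=` D ->
  (forall i, D i -> ~ A i -> a i = 0) -> usum D a = (\sum_(i \in D) a i)%:E.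
Proof.
move=> fA AD a0; rewrite (usum_widen AD a0) fset_usum//; congr EFin.
by apply: fsbig_widen => // i [Di nAi]; exact: a0.
Qed.

Lemma usum0 A a : (forall i, A i -> a i = 0) -> usum A a = 0%E.
Proof.
move=> a0; rewrite (@usum_widen set0)// ?fset_usum ?fsbig_set0// => i Ai _.
exact: a0.
Qed.

Lemma usumU A D a : A `&` D = set0 ->
  usum (A `|` D) a = (usum A a + usum D a)%E.
Proof.
move=> AD0.
have AUD : (A `|` D) `&` A = A by rewrite setUK.
have AUDC : (A `|` D) `&` ~` A = D.
  rewrite setIUl setICr set0U; apply/setIidl => i Di Ai.
  by have : set0 i by rewrite -AD0.
rewrite {1}/usum (esumID A); last by move=> i _; exact: funepos_ge0.
rewrite [X in (_ - X)%E](esumID A); last by move=> i _; exact: funeneg_ge0.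
rewrite AUD AUDC.
(* The sums of negative parts are nonnegative, so the opposite distributes over them; regrouping the
   four terms is valid at infinite values too. *)
rewrite oppeD; first exact: addeACA.
by apply: ge0_adde_def; rewrite inE; apply: esum_ge0 => i _;
  exact: funeneg_ge0.
Qed.

End UnorderedSums.

Lemma reindex_usum (R : realType) (S T : choiceType) (A : set S) (h : S -> T)
    (a : T -> R) :
  injective h -> usum (h @` A) a = usum A (a \o h).
Proof.
move=> h_inj; have hA : set_inj A h by move=> x y _ _ /h_inj.
rewrite /usum !(esum_image A h)//; congr (_ - _)%E; apply: eq_esum => i _.
  by rewrite !funeposE.
by rewrite !funenegE.
Qed.

(** Disjointness makes [(k, x) |-> x] a bijection from the pairs with [x] in [J k] onto the
    union. *)
Lemma esum_bigcup_choice (R : realType) (K T : choiceType) (J : K -> set T)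
    (a : T -> \bar R) : trivIset [set: K] J -> (forall x, 0 <= a x)%E ->
  \esum_(x in \bigcup_k J k) a x = \esum_(k in [set: K]) \esum_(x in J k) a x.
Proof.
move=> tJ a0; rewrite esum_esum//; apply: reindex_esum; split.
- by move=> [k x] [_ Jkx]; exists k.
- move=> [k x] [k' x'] /set_mem[_ /= Jkx] /set_mem[_ /= Jkx'] /= xx'.
  by move: Jkx'; rewrite -xx' => Jk'x; rewrite (tJ k k')//; exists x.
- by move=> x [k _ Jkx]; exists (k, x).
Qed.

(** * Edges, transition probabilities and the vectors q^(n) *)

Section Network.
Variables (R : realType) (B : gbratteli).
Variables (p : forall n, bd_V0 B -> bd_E B n -> R) (q0 : bd_V0 B -> R).
Hypotheses (hp : markov_matrices p) (hq0 : forall v, 0 < q0 v).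
Local Notation V0 := (bd_V0 B).
Local Notation q := (qvec p q0).

Lemma finite_edges n (w v : V0) : finite_set (edges n w v).
Proof. exact: bd_finite_edges. Qed.

(** An empty [fset_set] could also come from an infinite set; [finite_edges] excludes this. *)
Lemma incidence_neq0 n (w v : V0) :
  incidence (@bd_src B n) (@bd_rng B n) v w != 0%N <-> edges n w v !=set0.
Proof.
rewrite /incidence -/(edges n w v) finmap.cardfs_eq0; split=> [E0|[e wv]].
  by apply/set0P; apply: contraNneq E0 => ->; rewrite fset_set0.
apply/eqP => /fset_set_set0 E0; have : set0 e; last by [].
by rewrite -E0//; exact: finite_edges.
Qed.

Lemma finite_sources n (v : V0) : finite_set [set w | edges n w v !=set0].
Proof.
apply: sub_finite_set (bd_finite_row n v) => w /= wv.
exact/incidence_neq0.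
Qed.

Lemma phat_ge0 n v u : 0 <= phat p n v u.
Proof. by apply: fsumr_ge0 => e _; case: (hp n v). Qed.

Lemma phat_eq0 n (v u : V0) : ~ (edges n v u !=set0) -> phat p n v u = 0.
Proof.
by move=> /set0P/negP/negPn/eqP E0; rewrite /phat E0 fsbig_set0.
Qed.

Lemma phat_gt0 n (v u : V0) : edges n v u !=set0 -> 0 < phat p n v u.
Proof.
move=> [e vu]; have [p_ge0 p_gt0 _] := hp n v.
rewrite lt0r phat_ge0 andbT; apply/eqP => /pfsumr_eq0 p0.
have : 0 < p v e by apply/p_gt0; case: vu.
by rewrite p0 ?ltxx//; exact: finite_edges.
Qed.

(** The edges leaving [v] are partitioned by their range, so this is the Markov condition summed in
    blocks. *)
Lemma esum_phat n v : \esum_(u in [set: V0]) (phat p n v u)%:E = 1%E.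
Proof.
have [p_ge0 _ <-] := hp n v.
have -> : [set e | bd_src e = v] = \bigcup_(u in [set: V0]) edges n v u.
  by apply/seteqP; split => [e /= ev|e [u _ []//]]; exists (bd_rng e).
rewrite esum_bigcup_choice;
  [|by move=> u u' _ _ [e [[_ <-] [_ <-]]]
  |by move=> e; rewrite lee_fin].
apply: eq_esum => u _; have fE := finite_edges n v u.
by rewrite esum_fset// ?fsumEFin// => e _; rewrite lee_fin.
Qed.

(** Induction on [n]: no row of F_n is zero, so every vertex of level n+1 receives an edge, whose
    source contributes a positive term. *)
Lemma qvec_gt0 n v : 0 < q n v.
Proof.
elim: n v => [|n IH] u //=.
have [w /incidence_neq0 wu] := bd_row_neq0 (g := B) n u.
rewrite lt0r fsumr_ge0 ?andbT; last first.
  by move=> v _; rewrite mulr_ge0 ?phat_ge0 ?ltW.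
(* Over a finite index set, a zero sum of nonnegative terms has only zero terms; hence the
   restriction to the sources of edges into [u]. *)
rewrite -(@fsbig_widen _ _ _ _ [set v | edges n v u !=set0])//; last first.
  by move=> v [_ /= /phat_eq0 ->]; rewrite mulr0.
apply/eqP => /pfsumr_eq0 q0'.
have : 0 < q n w * phat p n w u by rewrite mulr_gt0 ?phat_gt0.
rewrite q0' ?ltxx//; first exact: finite_sources.
by move=> v _; rewrite mulr_ge0 ?phat_ge0 ?ltW.
Qed.

Lemma qvecS n u :
  usum [set: V0] (fun v => q n v * phat p n v u) = (q n.+1 u)%:E.
Proof.
apply: (finite_support_usum (finite_sources n u)) => // v _ /phat_eq0 ->.
by rewrite mulr0.
Qed.

(** Reversibility: both sides are twice the conductance between [v] and [u]. *)
Lemma qvec_qhat n u v : q n.+1 u * qhat p q0 n u v = q n v * phat p n v u.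
Proof. by rewrite /qhat mulrA mulrCA divff ?mulr1// gt_eqF ?qvec_gt0. Qed.

Lemma qhat_eq0 n (u v : V0) : ~ (edges n v u !=set0) -> qhat p q0 n u v = 0.
Proof. by move=> /phat_eq0 vu; rewrite /qhat vu mulr0. Qed.

(** * The Markov operator and the forms of harmonicity *)

Lemma adjacentE n (v : V0) : [set y | adjacent (n, v) y] =
  pair n.+1 @` [set u | edges n v u !=set0] `|`
  (if n is k.+1 then pair k @` [set w | edges k w v !=set0] else set0).
Proof.
apply/seteqP; split => [[m u]|[m u]].
  case=> /= -[]; first by move=> -> vu; left; exists u.
  by move=> -> uv; right; exists u.
case=> [[u' vu' [<- <-]]|]; first by left.
by case: n => [|n] //= [u' vu' [<- <-]]; right.
Qed.

Lemma markov_op_level f n v : markov_op p q0 f (n, v) =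
  (2^-1%:E * (matvec (phat p n) (level f n.+1) v + qhat_prev p q0 f n v))%E.
Proof.
have pair_inj m : injective (pair m : V0 -> vertex B) by move=> u w [].
have half_gt0 : 0 < 2^-1 :> R by rewrite invr_gt0.
rewrite gt0_muleDr//.
rewrite /markov_op adjacentE usumU.
- rewrite reindex_usum//; congr (_ + _)%E.
    rewrite /matvec -usum_pZl//.
    rewrite [RHS](@usum_widen _ _ [set u | edges n v u !=set0])//.
      by apply: eq_usum => u _ /=; rewrite /markov_kernel /= eqxx mulrA.
    by move=> u _ /phat_eq0 ->; rewrite mul0r mulr0.
  case: n => [|n] /=.
    by rewrite mule0 usum0.
  rewrite reindex_usum// /matvec -usum_pZl//.
  rewrite [RHS](@usum_widen _ _ [set w | edges n w v !=set0])//.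
    apply: eq_usum => w _ /=; rewrite /markov_kernel /= eqxx mulrA.
    (* From level n+1 to level n, the first test of [markov_kernel] compares n with n+2 and
       fails. *)
    by rewrite ltn_eqF.
  by move=> u _ /qhat_eq0 ->; rewrite mul0r mulr0.
- case: n => [|n]; first by rewrite setI0.
  by rewrite -subset0 => -[m u] /= [[u' _ [<- _]] [w' _ [/eqP]]];
    rewrite ltn_eqF.
Qed.

Lemma harmonicP f : is_harmonic p q0 f <-> forall n v, (2 * level f n v)%:E =
  (matvec (phat p n) (level f n.+1) v + qhat_prev p q0 f n v)%E.
Proof.
split => [hf n v|hf [n v]].
  have := hf (n, v); rewrite markov_op_level /level => fnv.
  by rewrite EFinM -fnv muleA -EFinM divff// mul1e.
by rewrite markov_op_level -hf -EFinM mulKf.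
Qed.

Lemma matvec_diag (T : choiceType) (d g : T -> R) t :
  matvec (diag_matrix d) g t = (d t * g t)%:E.
Proof.
rewrite /matvec (@usum_widen _ _ [set t])//.
  by rewrite fset_usum// fsbig_set1 /diag_matrix eqxx.
move=> i _ /= it; rewrite /diag_matrix.
by case: eqP => [/esym//|]; rewrite mul0r.
Qed.

Lemma weighted_matvec (T : choiceType) (d : V0 -> R) (A : V0 -> T -> R) g v :
  0 < d v -> matvec (fun s t => d s * A s t) g v = ((d v)%:E * matvec A g v)%E.
Proof.
by move=> dv; rewrite /matvec -usum_pZl//; apply: eq_usum => t _; rewrite mulrA.
Qed.

Lemma weighted_qhat_prevE (d : V0 -> R) f n v : 0 < d v ->
  weighted_qhat_prev p q0 d f n v = ((d v)%:E * qhat_prev p q0 f n v)%E.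
Proof. by case: n => [|n] dv /=; [rewrite mule0 | exact: weighted_matvec]. Qed.

Lemma harmonic_weightedP f : is_harmonic p q0 f <-> forall n v,
  matvec (diag_matrix (fun v => 2 * q n v)) (level f n) v =
  (matvec (fun v u => q n v * phat p n v u)%R (level f n.+1) v
   + weighted_qhat_prev p q0 (q n) f n v)%E.
Proof.
rewrite harmonicP.
suff E n v : ((2 * level f n v)%:E =
    (matvec (phat p n) (level f n.+1) v + qhat_prev p q0 f n v)%E) <->
  (matvec (diag_matrix (fun v => 2 * q n v)) (level f n) v =
  (matvec (fun v u => q n v * phat p n v u)%R (level f n.+1) v
   + weighted_qhat_prev p q0 (q n) f n v)%E).
  by split => h n v; apply/E.
have qn := qvec_gt0 n v.
rewrite matvec_diag weighted_matvec// weighted_qhat_prevE// -gt0_muleDr//.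
rewrite -mulrA mulrCA (EFinM (q n v)); split => [-> //|].
(* The product is associative on all of [\bar R], so the positive factor also cancels at infinite
   [x]. *)
have qK x : (((q n v)^-1)%:E * ((q n v)%:E * x) = x)%E.
  by rewrite muleA -EFinM mulVf ?mul1e// gt_eqF.
by move=> /(congr1 (fun x => ((q n v)^-1)%:E * x)%E); rewrite !qK.
Qed.

(** * The row vector q^(n) M, column by column *)

Lemma qvecME n x : qvecM p q0 n x =
  (2^-1 * (qvec_ext p q0 n.+1 x + qvec_ext_prev p q0 n x))%:E.
Proof.
have half_gt0 : 0 < 2^-1 :> R by rewrite invr_gt0.
case: x => k u.
rewrite /qvecM /vecmat /markov_kernel /qvec_ext_prev /qvec_ext /=.
case: eqVneq => [->|kn].
  transitivity (2^-1%:E * usum [set: V0] (fun v => q n v * phat p n v u)%R)%E.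
    by rewrite -usum_pZl//; apply: eq_usum => v _; rewrite mulrCA.
  rewrite qvecS -EFinM; congr (2^-1 * _)%:E.
  by case: n => [|n]; rewrite ?addr0// gtn_eqF ?addr0// leqW.
(* For n = 0 there is no lower level, so the column is zero. *)
rewrite add0r; case: n kn => [|n] kn.
  by rewrite mulr0 usum0// => v _; rewrite mulr0.
rewrite eqSS eq_sym; case: eqVneq => [->|kn'].
  (* On the lower level, reversibility pulls out [q n u]; what remains is a possibly infinite row
     sum of [phat], equal to 1. *)
  transitivity ((2^-1 * q n u)%R%:E * usum [set: V0] (phat p n u))%E.
    rewrite -usum_pZl ?mulr_gt0 ?qvec_gt0//; apply: eq_usum => v _.
    by rewrite mulrCA qvec_qhat mulrA.
  by rewrite ge0_usum ?esum_phat ?mule1// => v _; exact: phat_ge0.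
by rewrite mulr0 usum0// => v _; rewrite mulr0.
Qed.

End Network.

Theorem theorem4p5 (R : realType) (B : gbratteli)
    (p : forall n, bd_V0 B -> bd_E B n -> R) (q0 : bd_V0 B -> R)
    (hp : markov_matrices p) (hq0 : forall v, 0 < q0 v) :
  (forall f : vertex B -> R,
     [/\ is_harmonic p q0 f <->
           (forall n (v : bd_V0 B),
              (2 * level f n v)%:E =
              (usum [set: bd_V0 B]
                 (fun u => phat p n v u * level f n.+1 u)%R
               + (if n is k.+1 then
                    usum [set: bd_V0 B]
                      (fun w => qhat p q0 k v w * level f k w)%R
                  else 0))%E),
         is_harmonic p q0 f <->
           (forall n,
              (fun v => (2 * level f n v)%:E) =
              (matvec (phat p n) (level f n.+1) \+ qhat_prev p q0 f n)%E) &
         is_harmonic p q0 f <->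
           (forall n,
              matvec (diag_matrix (fun v => 2 * qvec p q0 n v)) (level f n) =
              (matvec (fun v u => qvec p q0 n v * phat p n v u)%R
                 (level f n.+1)
               \+ weighted_qhat_prev p q0 (qvec p q0 n) f n)%E)]) /\
  (forall n,
     qvecM p q0 n =
     (fun x => (2^-1 * (qvec_ext p q0 n.+1 x + qvec_ext_prev p q0 n x))%:E)).
Proof.
split=> [f|n]; last by apply: funext => x; exact: qvecME.
split.
(* Splitting on [n] makes the inline [if] and [qhat_prev] agree by computation. *)
- rewrite harmonicP; split => h n v; have := h n v; by case: n h => [|n] h.
- rewrite harmonicP; split => h n; first by apply: funext => v; exact: h.
  by move=> v; have := h n => /(congr1 (fun g => g v)).
- rewrite harmonic_weightedP//; split => h n;
    first by apply: funext => v; exact: h.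
  by move=> v; rewrite h.
Qed.
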